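(* Fix $y\in\mathbb{R}$. Let $S_y=[\tfrac12,1]^2$ and $S_X=[0,\tfrac12]^2$. Consider an individual with a stable indifference value $y_i^*\in\mathbb{R}$ and mean-zero noises $\varepsilon_c,\varepsilon_v$ with CDFs $F_c,F_v$, and put $\mathbb{P}_{ci}(y)=F_c(y-y_i^* )$ and $\mathbb{P}_{vi}(y)=F_v(y-y_i^* )$. Under the assumption of symmetric noises ($F_c$ and $F_v$ are continuous with $F_c(x)=1-F_c(-x)$ and $F_v(x)=1-F_v(-x)$ for all $x\in\mathbb{R}$): 1. the attainable set satisfies $\mathcal{A}_i=S_y\cup S_X$; 2. if $y>y_i^*$, then $(\mathbb{P}_{ci}(y),\mathbb{P}_{vi}(y))\in S_y$, and if $y<y_i^*$, then $(\mathbb{P}_{ci}(y),\mathbb{P}_{vi}(y))\in S_X$; 3. if $y=y_i^*$, then $(\mathbb{P}_{ci}(y),\mathbb{P}_{vi}(y))=(\tfrac12,\tfrac12)$.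
   Context: Individual $i$ compares a lottery $X$ to a sure amount $y$. The individual has a (stable) indifference value $y_i^*\in\mathbb{R}$ used for both choice and valuation tasks. In a choice task the individual chooses $y$ over $X$ when $y_i^*+\varepsilon_c\le y$, so $\mathbb{P}_{ci}(y)=\mathbb{P}(y_i^*+\varepsilon_c\le y)=F_c(y-y_i^* )$; in a valuation task the reported valuation is $y_i^*+\varepsilon_v$, so $\mathbb{P}_{vi}(y)=\mathbb{P}(y_i^*+\varepsilon_v\le y)=F_v(y-y_i^* )$. The noises $\varepsilon_c,\varepsilon_v$ are real random variables with mean zero. Attainable set: given assumptions on the distribution of $(\varepsilon_c,\varepsilon_v)$, $\mathcal{A}_i$ is the set of all $(a,b)\in[0,1]^2$ such that $F_c(y-y_i^* )=a$ and $F_v(y-y_i^* )=b$ for some $y_i^*\in\mathbb{R}$ and some distribution of $(\varepsilon_c,\varepsilon_v)$ consistent with the assumptions (here: mean zero and symmetric noises). *)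

(* Defs.v *)
From HB Require Import structures.
From mathcomp Require Import all_boot all_order all_algebra.
From mathcomp Require Import all_classical all_reals all_analysis.

Set Implicit Arguments.
Unset Strict Implicit.
Unset Printing Implicit Defensive.

Import Order.TTheory GRing.Theory Num.Theory.
Import numFieldNormedType.Exports.

Local Open Scope classical_set_scope.
Local Open Scope ring_scope.

(* [cdf] takes values in [\bar R]; it is always finite. *)
Definition rcdf d (T : measurableType d) (R : realType) (P : probability T R)
  (X : {RV P >-> R}) (x : R) : R := fine (cdf X x).

(* F(y - ystar), for a choice (F = F_c) or a valuation (F = F_v) task. *)
Definition task_prob d (T : measurableType d) (R : realType)
  (P : probability T R) (ystar : R) (eps : {RV P >-> R}) (y : R) : R :=
  rcdf eps (y - ystar).

Lemma task_probE d (T : measurableType d) (R : realType) (P : probability T R)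
    (ystar : R) (eps : {RV P >-> R}) (y : R) :
  task_prob ystar eps y = fine (P [set w | ystar + eps w <= y]).
Proof.
rewrite /task_prob /rcdf /cdf /distribution /pushforward.
congr (fine (P _)); apply/seteqP; split=> w /=;
  by rewrite in_itv /= lerBrDl.
Qed.

Definition mean_zero d (T : measurableType d) (R : realType)
  (P : probability T R) (X : {RV P >-> R}) : Prop :=
  P.-integrable [set: T] (EFin \o X) /\ ('E_P[X] = 0)%E.

Definition symmetric_noise d (T : measurableType d) (R : realType)
  (P : probability T R) (X : {RV P >-> R}) : Prop :=
  continuous (rcdf X) /\ (forall x : R, rcdf X x = 1 - rcdf X (- x)).

(* Assumptions on the noises (eps_c, eps_v), defined on a common probability
   space so that their joint distribution is arbitrary. *)
Definition noise_assumption (R : realType) :=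
  forall (d : measure_display) (T : measurableType d) (P : probability T R),
    {RV P >-> R} -> {RV P >-> R} -> Prop.

Definition mean_zero_symmetric_noises (R : realType) : noise_assumption R :=
  fun d T P eps_c eps_v =>
    [/\ mean_zero eps_c, mean_zero eps_v,
        symmetric_noise eps_c & symmetric_noise eps_v].

(* Both the indifference value and the distribution of the noises are
   existentially quantified, so nothing here depends on the individual. *)
Definition attainable_set (R : realType) (A : noise_assumption R) (y : R) :
    set (R * R) :=
  [set ab | [/\ 0 <= ab.1 <= 1, 0 <= ab.2 <= 1 &
    exists (ystar : R) (d : measure_display) (T : measurableType d)
      (P : probability T R) (eps_c eps_v : {RV P >-> R}),
      [/\ A d T P eps_c eps_v,
          rcdf eps_c (y - ystar) = ab.1 &
          rcdf eps_v (y - ystar) = ab.2]]].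

Definition S_y (R : realType) : set (R * R) :=
  `[1 / 2, 1]%classic `*` `[1 / 2, 1]%classic.

Definition S_X (R : realType) : set (R * R) :=
  `[0, 1 / 2]%classic `*` `[0, 1 / 2]%classic.

Arguments S_y R : clear implicits.
Arguments S_X R : clear implicits.

(* Main.v *)
(* A symmetric continuous CDF is nondecreasing with value 1/2 at 0, which gives
   the inclusions in [S_y] and [S_X].  Conversely, let U be uniform on [-1, 1]
   and push it away from 0 by a gap c in [0, 1]: the noise U +- c is symmetric,
   its CDF is flat at 1/2 on [-c, c], and its value at 1 is 1 - c / 2, which
   ranges over [1/2, 1].  Two gaps on the same U realize any pair in [S_y] with
   ystar = y - 1, and any pair in [S_X] with ystar = y + 1. *)
Require Import Defs.
From HB Require Import structures.
From mathcomp Require Import all_boot all_order all_algebra.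
From mathcomp Require Import all_classical all_reals all_analysis.
From mathcomp Require Import measurable_realfun lra.
Import Order.TTheory GRing.Theory Num.Theory.
Import numFieldNormedType.Exports.
Local Open Scope classical_set_scope.
Local Open Scope ring_scope.

Section rcdf_theory.
Context {d} {T : measurableType d} {R : realType} {P : probability T R}.
Implicit Types X : {RV P >-> R}.

Lemma rcdfK X x : (rcdf X x)%:E = cdf X x.
Proof. by rewrite /rcdf fineK// fin_num_measure. Qed.

Lemma rcdf_ge0 X x : 0 <= rcdf X x.
Proof. by rewrite -lee_fin rcdfK cdf_ge0. Qed.

Lemma rcdf_le1 X x : rcdf X x <= 1.
Proof. by rewrite -lee_fin rcdfK cdf_le1. Qed.

Lemma rcdf_nondecreasing X : nondecreasing_fun (rcdf X).
Proof. by move=> x z xz; rewrite -lee_fin !rcdfK cdf_nondecreasing. Qed.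

Lemma symmetric_rcdf0 X : symmetric_noise X -> rcdf X 0 = 1 / 2.
Proof. by move=> [_ /(_ 0)]; rewrite oppr0 => ?; lra. Qed.

Lemma symmetric_rcdf_ge0 X x : symmetric_noise X -> 0 <= x ->
  1 / 2 <= rcdf X x <= 1.
Proof.
move=> /symmetric_rcdf0 <- x0.
by rewrite rcdf_le1 rcdf_nondecreasing.
Qed.

Lemma symmetric_rcdf_le0 X x : symmetric_noise X -> x <= 0 ->
  0 <= rcdf X x <= 1 / 2.
Proof.
move=> /symmetric_rcdf0 <- x0.
by rewrite rcdf_ge0 rcdf_nondecreasing.
Qed.

(* The two tail integrals whose difference is [E X] are exchanged by
   [r |-> - r]. *)
Lemma symmetric_mean_zero X : P.-integrable [set: T] (EFin \o X) ->
  symmetric_noise X -> mean_zero X.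
Proof.
move=> iX [_ sX]; split=> //.
have L1X : (X : T -> R) \in Lfun P 1 by exact/Lfun1_integrable.
have mN : measurable_fun [set: R] (fun r => ccdf X (- r)).
  by apply: measurableT_comp => //; exact: ccdf_measurable.
have := expectation_fin_num L1X.
rewrite expectation_cdf_ccdf; last by rewrite inE in L1X.
(* The substitution carries the integral of [ccdf X] onto []-oo, 0]]; dropping the null endpoint
   matches the domain []-oo, 0[] of the [cdf X] integral. *)
rewrite ge0_integration_by_substitution0//; last exact: ccdf_measurable.
rewrite -integral_itv_bndo_bndc; last first.
  exact: measurable_funTS mN.
under eq_integral.
  move=> r _; rewrite ccdf_1_cdf -rcdfK sX opprK -EFinB opprB addrCA subrr addr0.
  rewrite rcdfK; over.
(* Both integrals are now [I]. Finiteness of the expectation excludes an infinite [I], for which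
   [I - I] would not be 0. *)
set I := integral _ _ _; case: I => [r| |] //=.
by rewrite -EFinB subrr.
Qed.

End rcdf_theory.

Section spread_uniform.
Context {R : realType}.
Implicit Types c u x : R.

(** CDF of the uniform law on [[0, 1]]. *)
Definition clamp01 x : R := Num.max 0 (Num.min 1 x).

Lemma uniform_prob_le x (lt11 : (-1 : R) < 1) :
  uniform_prob lt11 `]-oo, x] = (clamp01 ((x + 1) / 2))%:E.
Proof.
rewrite /uniform_prob integral_uniform_pdf.
rewrite (eq_integral (fun=> (2^-1)%:E)); last first.
  move=> u; rewrite inE/= => -[_]; rewrite in_itv/= /uniform_pdf => ->.
  by rewrite opprK.
rewrite integral_cst//=; last exact: measurableI.
rewrite (_ : `]-oo, x] `&` `[-1, 1] = `[-1, Num.min x 1]%classic); last first.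
  apply/seteqP; split=> u /=; rewrite !in_itv/= le_min.
    by move=> [-> /andP[-> ->]].
  by move=> /andP[-> /andP[-> ->]].
rewrite lebesgue_measure_itv/= lte_fin /clamp01.
have [x1|x1] := leP x 1; have [xN|xN] := ltP (-1) _.
- by rewrite -EFinD -EFinM; congr EFin; rewrite min_r ?max_r; lra.
- by rewrite mule0; congr EFin; rewrite min_r ?max_l; lra.
- by rewrite -EFinD -EFinM; congr EFin; rewrite min_l ?max_r; lra.
- by exfalso; lra.
Qed.

(** Sending 0 to [- c] rather than [c] makes each preimage of []-oo, x]] a closed half-line when
    [0 <= c], so that an upper adjoint exists. *)
Definition spread c u := if u <= 0 then u - c else u + c.

(* The soft threshold, upper adjoint of [spread c] (lemma [spread_le]). *)
Definition shrink c x := Num.max (x - c) 0 + Num.min (x + c) 0.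

Lemma spread_le c u x : 0 <= c -> (spread c u <= x) = (u <= shrink c x).
Proof.
move=> c0; rewrite /spread /shrink.
have [u0|u0] := leP u 0; have [?|?] := leP (x - c) 0;
  have [?|?] := leP (x + c) 0; apply/idP/idP => ?; lra.
Qed.

Lemma shrinkN c x : shrink c (- x) = - shrink c x.
Proof.
rewrite /shrink.
by have [?|?] := leP (x - c) 0; have [?|?] := leP (x + c) 0;
   have [?|?] := leP (- x - c) 0; have [?|?] := leP (- x + c) 0; lra.
Qed.

(** The uniform law on [[-1, 1]] is invariant under negation. *)
Lemma clamp01_sym x : clamp01 ((x + 1) / 2) = 1 - clamp01 ((- x + 1) / 2).
Proof.
rewrite /clamp01.
have [?|?] := leP 1 ((x + 1) / 2); have [?|?] := leP 1 ((- x + 1) / 2);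
  do ?[case: (leP 0 _) => ?]; lra.
Qed.

Lemma continuous_shrink c : continuous (shrink c).
Proof.
move=> x; apply: cvgD.
- apply: (@continuous_max _ _ (fun x => x - c) (cst 0)); last exact: cvg_cst.
  by apply: cvgB => //; exact: cvg_cst.
- apply: (@continuous_min _ _ (fun x => x + c) (cst 0)); last exact: cvg_cst.
  by apply: cvgD => //; exact: cvg_cst.
Qed.

Lemma continuous_clamp01 : continuous clamp01.
Proof.
move=> x; apply: (@continuous_max _ _ (cst 0)); first exact: cvg_cst.
by apply: (@continuous_min _ _ (cst 1) id) => //; exact: cvg_cst.
Qed.

Lemma measurable_spread c : measurable_fun [set: R] (spread c).
Proof.
apply: measurable_fun_if => //=.
- exact: measurable_fun_ler.
- by apply: measurable_funTS; exact: measurable_funB.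
- by apply: measurable_funTS; exact: measurable_funD.
Qed.

Context (lt11 : (-1 : R) < 1).
Let U := uniform_prob lt11.

(* [uniform_prob] lives on [measurableTypeR R], not on the canonical measurable
   structure of [R]. *)
HB.instance Definition _ c := @isMeasurableFun.Build _ _ (measurableTypeR R) R
  (spread c : measurableTypeR R -> R) (measurable_spread c).

Definition spread_noise c : {RV U >-> R} :=
  (spread c : measurableTypeR R -> R).

Lemma rcdf_spread_noise c x : 0 <= c ->
  rcdf (spread_noise c) x = clamp01 ((shrink c x + 1) / 2).
Proof.
move=> c0; rewrite /rcdf /cdf /distribution /pushforward.
rewrite (_ : _ @^-1` _ = `]-oo, shrink c x]%classic).
  exact: (congr1 fine (uniform_prob_le _ _)).
by apply/seteqP; split=> u /=; rewrite !in_itv/= spread_le.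
Qed.

(** [shrink c] is odd and continuous: the jump of [spread c] at 0 becomes a plateau of the CDF, not
    a discontinuity. *)
Lemma symmetric_spread_noise c : 0 <= c -> symmetric_noise (spread_noise c).
Proof.
move=> c0; split=> [x|x]; last first.
  by rewrite !rcdf_spread_noise// shrinkN clamp01_sym.
have -> : rcdf (spread_noise c) = fun z => clamp01 ((shrink c z + 1) / 2).
  by apply/funext => z; exact: rcdf_spread_noise.
apply: (@continuous_comp _ _ _ (fun z => (shrink c z + 1) / 2) clamp01);
  last exact: continuous_clamp01.
apply: cvgM; last exact: cvg_cst.
by apply: cvgD; [exact: continuous_shrink | exact: cvg_cst].
Qed.

Lemma integrable_spread_noise c : 0 <= c ->
  U.-integrable [set: R] (EFin \o spread_noise c).
Proof.
move=> c0; apply/integrableP; split; first exact/measurable_EFinP.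
rewrite integral_uniform//; last first.
  by apply: measurableT_comp => //; exact/measurable_EFinP.
(* On [[-1, 1]] the absolute value of [spread c] is at most [1 + c]. *)
apply: (@le_lt_trans _ _ ((1 - -1)^-1%:E *
    \int[lebesgue_measure]_(x in `[(-1)%R, 1%R]) (1 + c)%:E)%E).
  rewrite lee_pmul2l//.
  apply: ge0_le_integral => //=.
  - apply/measurable_EFinP/measurableT_comp => //.
    exact: measurable_funTS (measurable_spread c).
  - move=> x; rewrite in_itv/= lee_fin /spread_noise/= /spread => x1.
    by case: ifPn; rewrite -?leNgt -?ltNge => x0; rewrite ler_norml; lra.
rewrite integral_cst//= lebesgue_measure_itv/= lte_fin lt11.
by rewrite -EFinD -!EFinM ltry.
Qed.

Lemma mean_zero_spread_noise c : 0 <= c -> mean_zero (spread_noise c).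
Proof.
move=> c0; apply: symmetric_mean_zero; first exact: integrable_spread_noise.
exact: symmetric_spread_noise.
Qed.

(** The gap [2 - 2 * a] is the solution [c] of [1 - c / 2 = a]; the bounds on [a] place it in
    [[0, 1]]. *)
Lemma rcdf_spread_noise1 a : 1 / 2 <= a <= 1 ->
  rcdf (spread_noise (2 - 2 * a)) 1 = a.
Proof.
move=> a01; rewrite rcdf_spread_noise; last lra.
have -> : shrink (2 - 2 * a) 1 = 2 * a - 1.
  by rewrite /shrink max_l ?min_r; lra.
by rewrite /clamp01 min_r ?max_r; lra.
Qed.

Lemma rcdf_spread_noiseN1 a : 0 <= a <= 1 / 2 ->
  rcdf (spread_noise (2 * a)) (-1) = a.
Proof.
move=> a01; have [_ ->] : symmetric_noise (spread_noise (2 * a)).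
  by apply: symmetric_spread_noise; lra.
(* By symmetry the value at 1 must be [1 - a], so the gap is put in the form that realizes [1 - a]
   there. *)
have {1}-> : 2 * a = 2 - 2 * (1 - a) by lra.
by rewrite opprK rcdf_spread_noise1; lra.
Qed.

End spread_uniform.

Theorem lemma1 (R : realType) (y : R) :
  attainable_set (@mean_zero_symmetric_noises R) y = S_y R `|` S_X R
  /\
  (forall (ystar : R) (d : measure_display) (T : measurableType d)
      (P : probability T R) (eps_c eps_v : {RV P >-> R}),
    mean_zero_symmetric_noises eps_c eps_v ->
    [/\ ystar < y ->
          S_y R (task_prob ystar eps_c y, task_prob ystar eps_v y),
        y < ystar ->
          S_X R (task_prob ystar eps_c y, task_prob ystar eps_v y) &
        y = ystar ->
          (task_prob ystar eps_c y, task_prob ystar eps_v y)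
            = (1 / 2, 1 / 2)]).
Proof.
have lt11 : (-1 : R) < 1 by lra.
split; last first.
  move=> ystar d T P ec ev [_ _ sc sv]; rewrite /task_prob; split=> [lty|lty|->].
  - by split; rewrite /= in_itv/= symmetric_rcdf_ge0// subr_ge0 ltW.
  - by split; rewrite /= in_itv/= symmetric_rcdf_le0// subr_le0 ltW.
  - by rewrite subrr !symmetric_rcdf0.
(* The assumptions constrain each noise separately, so both may be functions of the same uniform
   variable. *)
have attain ystar c e a b : 0 <= c -> 0 <= e -> 0 <= a <= 1 -> 0 <= b <= 1 ->
    rcdf (spread_noise lt11 c) (y - ystar) = a ->
    rcdf (spread_noise lt11 e) (y - ystar) = b ->
    attainable_set (@mean_zero_symmetric_noises R) y (a, b).
  move=> c0 e0 a01 b01 Ha Hb; split=> //.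
  exists ystar, _, _, _, (spread_noise lt11 c), (spread_noise lt11 e); split=> //.
  split; [exact: mean_zero_spread_noise | exact: mean_zero_spread_noise |
    exact: symmetric_spread_noise | exact: symmetric_spread_noise].
apply/seteqP; split=> [[a b] [/= _ _] | [a b]].
  move=> [ystar [d [T [P [ec [ev [[_ _ sc sv] <- <-]]]]]]].
  (* A tie gives [(1 / 2, 1 / 2)], which lies in both squares; it is filed under [S_y]. *)
  have [yy|yy] := leP ystar y; [left|right].
  - by split; rewrite /= in_itv/= symmetric_rcdf_ge0// subr_ge0.
  - by split; rewrite /= in_itv/= symmetric_rcdf_le0// subr_le0 ltW.
case=> -[/=]; rewrite !in_itv/= => aP bP.
- by apply: (attain (y - 1) (2 - 2 * a) (2 - 2 * b));
    rewrite ?subKr ?rcdf_spread_noise1//; lra.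
- by apply: (attain (y + 1) (2 * a) (2 * b));
    rewrite ?opprD ?addNKr ?addrA ?subrr ?add0r ?rcdf_spread_noiseN1//; lra.
Qed.
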